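(* Let $R$ be a ring, let $T$ be a tree, and let $\mathcal{X}$ be an indecomposable injective object of $(T,R\text{-Mod})$. Then $\mathcal{X}\cong e_*^w(E)$ for some $w$ which is either a vertex of $T$ or a vertex at infinity of $T$, and some indecomposable injective left $R$-module $E$.
   Context: Rings are associative with identity, not necessarily commutative. A quiver $Q$ consists of a set $V$ of vertices, a set $\Gamma$ of arrows and source and target maps $s,t:\Gamma\to V$; both sets may be infinite. Paths are finite composable sequences of arrows; each vertex is a trivial path. $(Q,R\text{-Mod})$ is the category of representations of $Q$ by left $R$-modules: a representation $\mathcal{X}$ assigns a left $R$-module $\mathcal{X}(v)$ to each vertex $v$ and a homomorphism $\mathcal{X}(a):\mathcal{X}(s(a))\to\mathcal{X}(t(a))$ to each arrow $a$; morphisms are natural transformations. A tree is a quiver $T$ with a vertex $v_0$ (the root) such that for every vertex $w$ of $T$ there is a unique path from $v_0$ to $w$. For a vertex $v$ of a tree $T$ and a left $R$-module $E$, $e_*^v(E)$ is the representation with $e_*^v(E)(u)=E$ if there is a (necessarily unique) path from $u$ to $v$, and $e_*^v(E)(u)=0$ otherwise, with $e_*^v(E)(a)=\mathrm{id}_E$ for every arrow $a$ whose source and target both carry $E$ (and $0$ for other arrows). A vertex at infinity of $T$ is a formal point $w$ associated with an infinite path $\cdots a_3a_2a_1$ of arrows of $T$ such that $s(a_1)$ is the root and $t(a_i)=s(a_{i+1})$ for all $i\ge 1$; distinct infinite paths give distinct vertices at infinity. For such $w$ and a left $R$-module $E$, $e_*^w(E)$ is the representation with value $E$ at each vertex $s(a_j),t(a_j)$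 ($j\ge1$), value $0$ at all other vertices, with $e_*^w(E)(a_j)=\mathrm{id}_E$ for all $j\geq 1$ (and $0$ for all other arrows). *)

(* Defs.v *)
From HB Require Import structures.
From mathcomp Require Import all_boot all_algebra.
From mathcomp Require Import boolp.

Set Implicit Arguments.
Unset Strict Implicit.
Unset Printing Implicit Defensive.

Import GRing.Theory.
Local Open Scope ring_scope.

Record quiver := Quiver {
  vertex : Type;
  arrow : Type;
  src : arrow -> vertex;
  tgt : arrow -> vertex
}.

(* Arrows are listed in the order in which they are traversed; the trivial
   path at u is the empty list, seen as a path from u to u. *)
Fixpoint is_path (Q : quiver) (u : vertex Q) (p : seq (arrow Q))
    (w : vertex Q) : Prop :=
  match p with
  | [::] => u = w
  | a :: p' => src a = u /\ is_path (tgt a) p' w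
  end.

Definition has_path (Q : quiver) (u w : vertex Q) : Prop :=
  exists p, is_path u p w.

Record tree := Tree {
  tree_quiver :> quiver;
  root : vertex tree_quiver;
  tree_unique_path :
    forall w : vertex tree_quiver, exists! p, is_path root p w
}.

(* The arrow called a_(i+1) in the mathematical notation has index i here. *)
Record vertex_at_infinity (T : tree) := VertexAtInfinity {
  inf_arrow : nat -> arrow T;
  inf_arrow_root : src (inf_arrow 0) = root T;
  inf_arrow_step : forall i : nat, tgt (inf_arrow i) = src (inf_arrow i.+1)
}.

Section Modules.
Variable R : pzRingType.

Definition zero_module (M : lmodType R) : Prop := forall x : M, x = 0.

Definition module_iso (M N : lmodType R) : Prop :=
  exists (f : {linear M -> N}) (g : {linear N -> M}),
    cancel f g /\ cancel g f.

(* The product type carries the module structure of the direct sum. *)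
Definition indecomposable_module (M : lmodType R) : Prop :=
  ~ zero_module M /\
  forall A B : lmodType R,
    module_iso M (A * B)%type -> zero_module A \/ zero_module B.

Definition injective_module (E : lmodType R) : Prop :=
  forall (A B : lmodType R) (i : {linear A -> B}) (f : {linear A -> E}),
    injective i -> exists g : {linear B -> E}, forall x, g (i x) = f x.

End Modules.

Section Representations.
Variables (R : pzRingType) (Q : quiver).

Record rep := Rep {
  rep_obj :> vertex Q -> lmodType R;
  rep_map : forall a : arrow Q, {linear rep_obj (src a) -> rep_obj (tgt a)}
}.

Record rep_hom (X Y : rep) := RepHom {
  hom_at :> forall v : vertex Q, {linear X v -> Y v};
  hom_natural : forall (a : arrow Q) (x : X (src a)),
    hom_at (tgt a) (rep_map X a x) = rep_map Y a (hom_at (src a) x)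
}.

(* Equality of morphisms is expressed pointwise throughout. *)
Definition rep_iso (X Y : rep) : Prop :=
  exists (f : rep_hom X Y) (g : rep_hom Y X),
    (forall v, cancel (f v) (g v)) /\ (forall v, cancel (g v) (f v)).

Definition rep_mono (X Y : rep) (i : rep_hom X Y) : Prop :=
  forall (Z : rep) (f g : rep_hom Z X),
    (forall v z, i v (f v z) = i v (g v z)) -> forall v z, f v z = g v z.

Definition injective_rep (X : rep) : Prop :=
  forall (A B : rep) (i : rep_hom A B) (f : rep_hom A X),
    rep_mono i -> exists g : rep_hom B X, forall v x, g v (i v x) = f v x.

Definition zero_rep (X : rep) : Prop := forall v, zero_module (X v).

Section DirectSum.
Variables (X Y : rep) (a : arrow Q).

Definition rep_sum_map (z : X (src a) * Y (src a)) :
    (X (tgt a) * Y (tgt a))%type :=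
  (rep_map X a z.1, rep_map Y a z.2).

Fact rep_sum_map_is_linear : linear rep_sum_map.
Proof. by move=> k z t; rewrite /rep_sum_map /= !linearP. Qed.

HB.instance Definition _ :=
  GRing.isLinear.Build R (X (src a) * Y (src a))%type
    (X (tgt a) * Y (tgt a))%type *:%R rep_sum_map rep_sum_map_is_linear.

End DirectSum.

Definition rep_sum (X Y : rep) : rep :=
  Rep (rep_obj := fun v => (X v * Y v)%type)
    (fun a => @rep_sum_map X Y a).

Definition indecomposable_rep (X : rep) : Prop :=
  ~ zero_rep X /\
  forall Y Z : rep, rep_iso X (rep_sum Y Z) -> zero_rep Y \/ zero_rep Z.

(* The empty row vectors 'rV[R]_0 serve as the zero module. *)
Definition module_if (E : lmodType R) (b : bool) : lmodType R :=
  if b then E else 'rV[R]_0.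

Definition id_if (E : lmodType R) (k b c : bool) :
    {linear module_if E b -> module_if E c} :=
  match k, b, c return {linear module_if E b -> module_if E c} with
  | true, true, true => (idfun : {linear E -> E})
  | _, _, _ => \0
  end.

(* An arrow outside K gets the zero map even when both of its endpoints
   carry E. *)
Definition rep_on (P : vertex Q -> Prop) (K : arrow Q -> Prop)
    (E : lmodType R) : rep :=
  Rep (rep_obj := fun u => module_if E `[< P u >])
    (fun a => id_if E `[< K a >] `[< P (src a) >] `[< P (tgt a) >]).

End Representations.

Definition e_vertex (R : pzRingType) (T : tree) (v : vertex T)
    (E : lmodType R) : rep R T :=
  rep_on (fun u => has_path u v)
    (fun a => has_path (src a) v /\ has_path (tgt a) v) E.

Definition e_infinity (R : pzRingType) (T : tree) (w : vertex_at_infinity T)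
    (E : lmodType R) : rep R T :=
  rep_on
    (fun u => exists j, u = src (inf_arrow w j) \/ u = tgt (inf_arrow w j))
    (fun a => exists j, a = inf_arrow w j) E.

(* Main.v *)
Require Import Defs.
From HB Require Import structures.
From mathcomp Require Import all_boot all_algebra.
From mathcomp Require Import boolp.

Set Implicit Arguments.
Unset Strict Implicit.
Unset Printing Implicit Defensive.

Import GRing.Theory.
Local Open Scope ring_scope.

(** An idempotent endomorphism of a representation splits it as image plus
    kernel, so an indecomposable X has only the idempotents 0 and 1
    ([indecomposable_idempotent]).  The proof produces idempotents from the
    injectivity of X, and each of them forces the shape of X.  Write u <= v
    when the tree has a path from u to v; arrows lead away from the root, and
    each vertex is the target of at most one arrow.  The socle of X at v is the
    submodule of the elements of X v that every arrow out of v kills.  Two cases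
    arise.

    Some socle E = soc_v X is nonzero.  Then E is injective, since maps into it
    are maps to X from representations concentrated at v.  The inclusion of the
    representation E concentrated at v extends to g : e_*^v(E) -> X, because X
    is injective.  A projection of X v onto E, composed with the transports
    from u to v for u <= v, gives r : X -> e_*^v(E).  An endomorphism of
    e_*^v(E) is determined by its value at v, so r g = 1 and g r is a nonzero
    idempotent.  Hence g r = 1 and X is isomorphic to e_*^v(E)
    ([vertex_case]).

    All socles are zero.  Then a map into X is determined by its values at the
    vertices that are not strictly below a given vertex c, since it can be
    recovered step by step along the path to c.  On the subrepresentation
    carried by these vertices, the map that is the identity at every u >= c and
    0 elsewhere extends to X; the extension is unique, and therefore
    idempotent.  It is 0 or 1, so X vanishes at every u >= c, or at every u
    incomparable to c ([zero_beyond_or_aside]).  Hence the support of X is a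
    chain.  Injectivity of X also makes every arrow act surjectively, which
    gives a support closed towards the root, and a zero socle prevents the
    support from ending and makes the arrows inside it act injectively.  So the
    support is an infinite path w starting at the root, along which X is
    constant: X is isomorphic to e_*^w(X root) ([infinity_case]).

    In both cases the value module inherits indecomposability from X, since a
    decomposition of E decomposes the representation ([rep_on_sum]), and it
    is injective ([socle_injective], [root_injective]). *)

(** * Submodules and linear maps *)

Record submodule (R : pzRingType) (M : lmodType R) := Submodule {
  in_submodule : M -> Prop;
  in_submodule0 : in_submodule 0;
  in_submoduleP : forall (k : R) (x y : M),
    in_submodule x -> in_submodule y -> in_submodule (k *: x + y) }.

Section SubmoduleType.
Variables (R : pzRingType) (M : lmodType R) (N : submodule M).
Definition submodule_mem (x : M) : bool := `[< in_submodule N x >].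
Fact submodule_mem_closed : submod_closed submodule_mem.
Proof.
split; first exact/asboolP/in_submodule0.
move=> k x y /asboolP Nx /asboolP Ny; exact/asboolP/in_submoduleP.
Qed.
HB.instance Definition _ :=
  GRing.isSubmodClosed.Build R M submodule_mem submodule_mem_closed.
Record submodule_type := SubmoduleElt {
  submodule_val : M; _ : submodule_mem submodule_val }.
HB.instance Definition _ := [isSub for submodule_val].
HB.instance Definition _ := [Choice of submodule_type by <:].
HB.instance Definition _ := [SubChoice_isSubLmodule of submodule_type by <:].

Lemma val_in_submodule (x : submodule_type) : in_submodule N (val x).
Proof. exact/asboolP/(valP x). Qed.

Section Corestriction.
Variables (L : lmodType R) (f : {linear L -> M}).
Hypothesis fN : forall x, in_submodule N (f x).
Definition corestrict (x : L) : submodule_type := SubmoduleElt (asboolT (fN x)).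
Fact corestrict_is_linear : linear corestrict.
Proof. by move=> k x y; apply: val_inj; rewrite /= linearP. Qed.
HB.instance Definition _ :=
  GRing.isLinear.Build R L submodule_type *:%R corestrict corestrict_is_linear.
End Corestriction.
End SubmoduleType.

Section PairLinear.
Variables (R : pzRingType) (A B C : lmodType R).
Definition pairing (f : {linear A -> B}) (g : {linear A -> C}) (x : A) :
  (B * C)%type := (f x, g x).
Fact pairing_is_linear f g : linear (pairing f g).
Proof. by move=> k x y; rewrite /pairing !linearP. Qed.
HB.instance Definition _ f g :=
  GRing.isLinear.Build R A (B * C)%type *:%R (pairing f g) (pairing_is_linear f g).
End PairLinear.

(** * Modules present only under a condition *)

Section InOut.
Variables (R : pzRingType) (E : lmodType R).
(** Together with [from_if], this lets a family of maps to or from E, indexed by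
    all vertices, stand for maps to or from [rep_on P K E]. *)
Definition into_if (b : bool) : {linear E -> module_if E b} :=
  if b return {linear E -> module_if E b} then (idfun : {linear E -> E}) else \0.
Definition from_if (b : bool) : {linear module_if E b -> E} :=
  if b return {linear module_if E b -> E} then (idfun : {linear E -> E}) else \0.
Lemma into_ifK (b : bool) : b -> cancel (into_if b) (from_if b).
Proof. by case: b. Qed.
Lemma from_ifK b : cancel (from_if b) (into_if b).
Proof. by case: b => //= x; apply/rowP => -[]. Qed.
Lemma id_ifE k b c x : id_if E k b c x = if k then into_if c (from_if b x) else 0.
Proof. by case: k b c x => [] [] []. Qed.
Lemma module_if0 b (x : module_if E b) : ~~ b -> x = 0.
Proof. by case: b x => // x _; rewrite -[x]from_ifK. Qed.
End InOut.
Arguments into_if {R E} b.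
Arguments from_if {R E} b.

(** * Representations of a quiver *)

Section Reps.
Variables (R : pzRingType) (Q : quiver).
Implicit Types X Y Z : rep R Q.

Definition hom_comp X Y Z (g : rep_hom Y Z) (f : rep_hom X Y) : rep_hom X Z.
Proof.
exists (fun v => (g v \o f v : {linear X v -> Z v})) => a x /=.
by rewrite !hom_natural.
Defined.

Lemma rep_iso_trans X Y Z : rep_iso X Y -> rep_iso Y Z -> rep_iso X Z.
Proof.
move=> [f [f' [fK f'K]]] [g [g' [gK g'K]]].
by exists (hom_comp g f), (hom_comp f' g'); split=> v x /=;
  rewrite (gK, f'K) (fK, g'K).
Qed.

Lemma injective_rep_mono X Y (i : rep_hom X Y) :
  (forall v, injective (i v)) -> rep_mono i.
Proof. by move=> i_inj Z f g fg v z; apply: i_inj. Qed.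

Lemma rep_iso_bij X Y (f : rep_hom X Y) :
  (forall v, injective (f v)) -> (forall v y, exists x, f v x = y) ->
  rep_iso X Y.
Proof.
move=> f_inj f_surj.
pose g v y := projT1 (cid (f_surj v y)).
have gK v : cancel (g v) (f v) by move=> y; rewrite /g; case: cid.
have fK v : cancel (f v) (g v) by move=> x; apply: f_inj; rewrite gK.
have g_lin v : linear (g v) by apply: can2_linear (fK v) (gK v).
pose gl v : {linear Y v -> X v} :=
  HB.pack (g v) (GRing.isLinear.Build _ _ _ _ _ (g_lin v)).
have g_nat a y : gl (tgt a) (rep_map Y a y) = rep_map X a (gl (src a) y).
  by apply: f_inj; rewrite hom_natural /= !gK.
by exists f, (RepHom g_nat).
Qed.

Section SubRep.
Variables (X : rep R Q) (N : forall v, submodule (X v)).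
Hypothesis N_stable : forall a x,
  in_submodule (N (src a)) x -> in_submodule (N (tgt a)) (rep_map X a x).

Definition subrep : rep R Q :=
  Rep (rep_obj := fun v => submodule_type (N v))
    (fun a => @corestrict _ _ (N (tgt a)) _
       (rep_map X a \o val : {linear submodule_type (N (src a)) -> X (tgt a)})
       (fun x => N_stable (val_in_submodule x))).

Definition subrep_incl : rep_hom subrep X :=
  @RepHom _ _ subrep X
    (fun v => (val : {linear submodule_type (N v) -> X v}))
    (fun a x => erefl).

Lemma subrep_incl_mono : rep_mono subrep_incl.
Proof. by apply: injective_rep_mono => v; apply: val_inj. Qed.
End SubRep.

Section Idempotent.
Variables (X : rep R Q) (phi : rep_hom X X).
Hypothesis phi_idem : forall v x, phi v (phi v x) = phi v x.

Definition fixed_submodule v : submodule (X v).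
Proof.
exists (fun x => phi v x = x); first by rewrite linear0.
by move=> k x y hx hy; rewrite linearP hx hy.
Defined.

Definition kernel_submodule v : submodule (X v).
Proof.
exists (fun x => phi v x = 0); first by rewrite linear0.
by move=> k x y hx hy; rewrite linearP hx hy scaler0 addr0.
Defined.

Fact fixed_stable a x : in_submodule (fixed_submodule (src a)) x ->
  in_submodule (fixed_submodule (tgt a)) (rep_map X a x).
Proof. by move=> /= hx; rewrite hom_natural hx. Qed.

Fact kernel_stable a x : in_submodule (kernel_submodule (src a)) x ->
  in_submodule (kernel_submodule (tgt a)) (rep_map X a x).
Proof. by move=> /= hx; rewrite hom_natural hx linear0. Qed.

(** X is the direct sum of the image of phi, written as its fixed points, and
    the kernel of phi, through x |-> (phi x, x - phi x). *)
Lemma indecomposable_idempotent : indecomposable_rep X ->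
  (forall v x, phi v x = 0) \/ (forall v x, phi v x = x).
Proof.
move=> [_ indec].
pose Y := subrep fixed_stable; pose Z := subrep kernel_stable.
have phiY v x : in_submodule (fixed_submodule v) (phi v x) by exact: phi_idem.
have phiZ v x : in_submodule (kernel_submodule v) ((idfun \- phi v) x).
  by rewrite /= linearB phi_idem subrr.
pose f v : {linear X v -> rep_sum Y Z v} :=
  pairing (corestrict (phiY v)) (corestrict (phiZ v)).
have f_nat a x : f (tgt a) (rep_map X a x) =
    rep_map (rep_sum Y Z) a (f (src a) x).
  by congr (_, _); apply: val_inj; rewrite /= ?linearB hom_natural.
have iso : rep_iso X (rep_sum Y Z).
  apply: (rep_iso_bij (f := RepHom f_nat)) => v /=.
    by move=> x y [fxy]; rewrite /= fxy => /addIr.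
  move=> [[y hy] [z hz]]; exists (y + z).
  have fy : phi v y = y := asboolW hy; have fz : phi v z = 0 := asboolW hz.
  by congr (_, _); apply: val_inj; rewrite /= linearD fy fz addr0 //
    addrAC subrr add0r.
case: (indec _ _ iso) => [Y0|Z0]; [left|right] => v x.
  by have /(congr1 val) := Y0 v (corestrict (phiY v) x).
have /(congr1 val)/= := Z0 v (corestrict (phiZ v) x).
by move/subr0_eq => <-.
Qed.
End Idempotent.

Section RepOn.
Variables (P : vertex Q -> Prop) (K : arrow Q -> Prop) (E : lmodType R).

Lemma rep_on_zero v (x : rep_on P K E v) : ~ P v -> x = 0.
Proof. by move=> nPv; apply: module_if0; apply/asboolPn. Qed.

Lemma rep_on_mapE a x : rep_map (rep_on P K E) a x =
  if `[< K a >] then into_if `[< P (tgt a) >] (from_if _ x) else 0.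
Proof. exact: id_ifE. Qed.

Lemma rep_on_map_in a x : K a -> P (tgt a) ->
  from_if _ (rep_map (rep_on P K E) a x) = from_if _ x.
Proof. by move=> Ka Pt; rewrite rep_on_mapE (asboolT Ka) into_ifK ?asboolT. Qed.

Section HomFrom.
Variables (X : rep R Q) (h : forall v, {linear E -> X v}).
Hypothesis h_in : forall a x, K a -> P (src a) -> P (tgt a) ->
  rep_map X a (h (src a) x) = h (tgt a) x.
Hypothesis h_out : forall a x, P (src a) -> ~ (K a /\ P (tgt a)) ->
  rep_map X a (h (src a) x) = 0.

Definition hom_from_rep_on : rep_hom (rep_on P K E) X.
Proof.
exists (fun v => (h v \o from_if `[< P v >] : {linear rep_on P K E v -> X v})).
move=> a x; case: (pselect (P (src a))) => [Ps|nPs]; last first.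
  by rewrite (rep_on_zero x nPs) !linear0.
case: (pselect (K a /\ P (tgt a))) => [[Ka Pt]|nKP] /=.
  by rewrite h_in // rep_on_map_in.
rewrite h_out // rep_on_mapE; case: (asboolP (K a)) => Ka; last by rewrite !linear0.
have nPt : ~ P (tgt a) by move=> Pt; apply: nKP.
by rewrite (module_if0 (into_if _ _)) ?linear0 //; apply/asboolPn.
Defined.
End HomFrom.

Section HomTo.
Variables (X : rep R Q) (h : forall v, {linear X v -> E}).
Hypothesis h_in : forall a x, K a -> P (src a) -> P (tgt a) ->
  h (tgt a) (rep_map X a x) = h (src a) x.
Hypothesis h_out : forall a x, P (tgt a) -> ~ (K a /\ P (src a)) ->
  h (tgt a) (rep_map X a x) = 0.

Definition hom_to_rep_on : rep_hom X (rep_on P K E).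
Proof.
exists (fun v => (into_if `[< P v >] \o h v : {linear X v -> rep_on P K E v})).
move=> a x; case: (pselect (P (tgt a))) => [Pt|nPt]; last first.
  by rewrite [LHS](rep_on_zero _ nPt) [RHS](rep_on_zero _ nPt).
rewrite rep_on_mapE /=; case: (pselect (K a /\ P (src a))) => [[Ka Ps]|nKP].
  by rewrite (asboolT Ka) into_ifK ?asboolT // h_in.
rewrite h_out // linear0; case: (asboolP (K a)) => // Ka.
have nPs : ~ P (src a) by move=> Ps; apply: nKP.
by rewrite (module_if0 (into_if `[< P (src a) >] _)) ?linear0 //; apply/asboolPn.
Defined.
End HomTo.
End RepOn.

Section RepOnIndec.
Variables (P : vertex Q -> Prop) (K : arrow Q -> Prop).

(** The functor [rep_on P K] is additive; this carries a decomposition of the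
    module E over to the representation. *)
Lemma rep_on_sum (E A B : lmodType R) : module_iso E (A * B)%type ->
  rep_iso (rep_on P K E) (rep_sum (rep_on P K A) (rep_on P K B)).
Proof.
move=> [f [f' [fK f'K]]].
pose h v : {linear rep_on P K E v -> rep_sum (rep_on P K A) (rep_on P K B) v} :=
  pairing (into_if `[< P v >] \o (fst \o (f \o from_if `[< P v >])))
          (into_if `[< P v >] \o (snd \o (f \o from_if `[< P v >]))).
have h_nat a x : h (tgt a) (rep_map (rep_on P K E) a x)
    = rep_map (rep_sum (rep_on P K A) (rep_on P K B)) a (h (src a) x).
  rewrite /h /= /rep_sum_map /pairing /=; move: x => /=.
  case: `[< K a >] `[< P (src a) >] `[< P (tgt a) >] => [] [] [] x //=;
    by rewrite ?linear0.
pose h' v : {linear rep_sum (rep_on P K A) (rep_on P K B) v -> rep_on P K E v} :=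
  into_if `[< P v >] \o (f' \o pairing (from_if `[< P v >] \o fst)
                                      (from_if `[< P v >] \o snd)).
have h'K v : cancel (h' v) (h v).
  move=> [y z]; rewrite /h /h' /pairing /=; move: y z => /=.
  case: `[< P v >] => y z; rewrite /pairing /=; first by rewrite f'K.
  by rewrite (module_if0 y) // (module_if0 z).
have hK v : cancel (h v) (h' v).
  move=> x; rewrite /h /h' /pairing /=; move: x => /=.
  case: `[< P v >] => x; rewrite /pairing /=;
    first by rewrite -surjective_pairing fK.
  by rewrite (module_if0 x).
apply: (rep_iso_bij (f := RepHom h_nat)) => v /=; first exact: can_inj (hK v).
by move=> y; exists (h' v y); apply: h'K.
Qed.

Lemma indecomposable_rep_on (X : rep R Q) (E : lmodType R) v : P v ->
  rep_iso X (rep_on P K E) -> indecomposable_rep X -> indecomposable_module E.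
Proof.
move=> Pv isoX [Xnz indec]; split=> [E0|A B isoE].
  have [f [g [fK _]]] := isoX.
  apply: Xnz => u x; rewrite -[x]fK -[f u x]from_ifK.
  by rewrite [from_if _ _]E0 !linear0.
have := indec _ _ (rep_iso_trans isoX (rep_on_sum isoE)).
have bv : `[< P v >] by apply/asboolP.
by case=> [Z|Z]; [left|right] => x;
  rewrite -[x](into_ifK bv) [into_if _ _]Z linear0.
Qed.
End RepOnIndec.
End Reps.

(** * Extending maps from one constant representation to another *)

Section Extension.
Variables (R : pzRingType) (Q : quiver) (X : rep R Q).
Variables (P P' : vertex Q -> Prop) (K K' : arrow Q -> Prop).
Variables (A B : lmodType R) (i : {linear A -> B}).
Hypothesis i_inj : injective i.
Hypothesis PP' : forall v, P v -> P' v.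
Hypothesis KK' : forall a, K a -> P (src a) -> P (tgt a) -> K' a.
Hypothesis K'K : forall a, P (src a) -> K' a -> P' (tgt a) -> K a /\ P (tgt a).

(** Under the conditions on P, P', K and K', the maps i form a monomorphism
    [rep_on P K A -> rep_on P' K' B]; the maps h form a morphism
    [rep_on P K A -> X], which injectivity extends along it.  All uses of
    the injectivity of X on constant representations are instances: from one
    vertex to all vertices before it, from the vertices beyond an arrow to
    those beyond its source, and from a module A to a larger B. *)
Lemma extend_from_rep_on (h : forall v, {linear A -> X v}) :
  injective_rep X ->
  (forall a x, K a -> P (src a) -> P (tgt a) ->
    rep_map X a (h (src a) x) = h (tgt a) x) ->
  (forall a x, P (src a) -> ~ (K a /\ P (tgt a)) ->
    rep_map X a (h (src a) x) = 0) ->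
  exists g : rep_hom (rep_on P' K' B) X,
    forall v x, P v -> g v (into_if `[< P' v >] (i x)) = h v x.
Proof.
move=> X_inj h_in h_out.
pose j v : {linear A -> rep_on P' K' B v} := into_if `[< P' v >] \o i.
have j_in a x : K a -> P (src a) -> P (tgt a) ->
    rep_map (rep_on P' K' B) a (j (src a) x) = j (tgt a) x.
  move=> Ka Ps Pt; rewrite rep_on_mapE /= (asboolT (KK' Ka Ps Pt)).
  by rewrite into_ifK // asboolT //; apply: PP'.
have j_out a x : P (src a) -> ~ (K a /\ P (tgt a)) ->
    rep_map (rep_on P' K' B) a (j (src a) x) = 0.
  move=> Ps nKP; rewrite rep_on_mapE; case: (asboolP (K' a)) => // K'a.
  apply: module_if0; apply/asboolPn => P't; apply: nKP; exact: K'K.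
have J_mono : rep_mono (hom_from_rep_on j_in j_out).
  apply: injective_rep_mono => v; case: (pselect (P v)) => [Pv|nPv]; last first.
    by move=> x y _; rewrite [LHS](rep_on_zero _ nPv) [RHS](rep_on_zero _ nPv).
  move=> x y /= /(congr1 (from_if _)).
  rewrite !into_ifK ?asboolT //; try exact: PP'.
  by move/i_inj/(congr1 (into_if `[< P v >])); rewrite !from_ifK.
have [g gE] := X_inj _ _ _ (hom_from_rep_on h_in h_out) J_mono.
exists g => v x Pv.
by have /= := gE v (into_if `[< P v >] x); rewrite into_ifK ?asboolT.
Qed.
End Extension.

(** * Paths in quivers and trees *)

Section Paths.
Variable Q : quiver.
Implicit Types (u v w : vertex Q) (p q : seq (arrow Q)).

Lemma is_path_cat u v w p q :
  is_path u p v -> is_path v q w -> is_path u (p ++ q) w.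
Proof. by elim: p u => [u <-|a p IH u [<- hp]] // hq; split=> //; apply: IH. Qed.

Lemma is_path_rcons u w p a :
  is_path u (rcons p a) w <-> is_path u p (src a) /\ tgt a = w.
Proof.
elim: p u => [|b p IH] u /=; first by split=> [[-> ->]|[-> ->]].
by rewrite IH; tauto.
Qed.

Lemma has_path_refl u : has_path u u.
Proof. by exists [::]. Qed.

Lemma has_path_trans u v w : has_path u v -> has_path v w -> has_path u w.
Proof. by move=> [p hp] [q hq]; exists (p ++ q); apply: is_path_cat hp hq. Qed.

Lemma has_path_arrow (a : arrow Q) : has_path (src a) (tgt a).
Proof. by exists [:: a]. Qed.

Lemma has_path_ind (S : vertex Q -> Prop) v : S v ->
  (forall a : arrow Q, has_path (tgt a) v -> S (tgt a) -> S (src a)) ->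
  forall u, has_path u v -> S u.
Proof.
move=> Sv Sa u [p]; elim: p u => [u ->|a p IH u [<- hp]] //.
by apply: Sa (IH _ hp); exists p.
Qed.

Lemma has_path_ind_last (S : vertex Q -> Prop) u : S u ->
  (forall a : arrow Q, has_path u (src a) -> S (src a) -> S (tgt a)) ->
  forall w, has_path u w -> S w.
Proof.
move=> Su Sa w [p]; elim/last_ind: p w => [w <-|p a IH w] //.
by move=> /is_path_rcons [hp <-]; apply: Sa (IH _ hp); exists p.
Qed.
End Paths.

Section TreePaths.
Variable T : tree.
Implicit Types (u v w : vertex T) (a b : arrow T).

Lemma has_path_root u : has_path (Defs.root T) u.
Proof. by have [p [hp _]] := tree_unique_path u; exists p. Qed.

Lemma tree_path_unique u w p q : is_path u p w -> is_path u q w -> p = q.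
Proof.
move=> hp hq; have [r hr] := has_path_root u.
have [s [_ s_uniq]] := tree_unique_path w.
have := s_uniq _ (is_path_cat hr hp); rewrite (s_uniq _ (is_path_cat hr hq)).
elim: r {hr} => //= c r IH [] //.
Qed.

Lemma tree_anti u w : has_path u w -> has_path w u -> u = w.
Proof.
move=> [p hp] [q hq].
have := tree_path_unique (is_path_cat hp hq) (erefl : is_path u [::] u).
by case: p hp.
Qed.

Lemma no_path_back a : ~ has_path (tgt a) (src a).
Proof.
move=> [p hp].
by have := tree_path_unique (p := a :: p) (conj erefl hp)
  (erefl : is_path _ [::] _).
Qed.

Lemma tgt_inj a b : tgt a = tgt b -> a = b.
Proof.
move=> eab; have [p hp] := has_path_root (src a).
have [q hq] := has_path_root (src b).
have hpa : is_path (Defs.root T) (rcons p a) (tgt a) by apply/is_path_rcons.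
have hqb : is_path (Defs.root T) (rcons q b) (tgt a) by apply/is_path_rcons.
by have [] := rcons_inj (tree_path_unique hpa hqb).
Qed.

Lemma has_path_tgt u a : has_path u (tgt a) -> u = tgt a \/ has_path u (src a).
Proof.
move=> [p]; case/lastP: p => [->|p b]; first by left.
by move=> /is_path_rcons[hp /tgt_inj eb]; right; exists p; rewrite -eb.
Qed.

Lemma branch_unique a b w : src a = src b ->
  has_path (tgt a) w -> has_path (tgt b) w -> a = b.
Proof.
move=> eab [p hp] [q hq].
by have [] := tree_path_unique (p := a :: p) (q := b :: q)
  (conj erefl hp) (conj (esym eab) hq).
Qed.
End TreePaths.

(** * Transport along paths *)

Section Transport.
Variables (R : pzRingType) (T : tree) (X : rep R T).
Implicit Types (u v w : vertex T) (a b : arrow T).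

Definition vertex_cast u v (e : u = v) : {linear X u -> X v} :=
  match e in _ = v return {linear X u -> X v} with
  | erefl => (idfun : {linear X u -> X u})
  end.

Fixpoint path_map p u w : is_path u p w -> {linear X u -> X w} :=
  match p return is_path u p w -> {linear X u -> X w} with
  | [::] => fun h => vertex_cast h
  | a :: p' => fun h =>
      path_map (proj2 h) \o (rep_map X a \o vertex_cast (esym (proj1 h)))
  end.

(** The map X u -> X w along the path from u to w, and 0 when there is none.
    Being defined for all pairs of vertices, it lets a statement about an arrow a
    with [src a = v] speak of elements of X v without casts. *)
Definition transport u w : {linear X u -> X w} :=
  if pselect (has_path u w) is left h
  then let: exist _ hp := cid h in path_map hp else \0.

Lemma transport_path u w p (h : is_path u p w) : transport u w =1 path_map h.
Proof.
move=> x; rewrite /transport; case: pselect => [h'|]; last by case; exists p.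
case: (cid h') => q hq; have e := tree_path_unique h hq; subst q.
by rewrite (Prop_irrelevance hq h).
Qed.

Lemma transport_refl u x : transport u u x = x.
Proof. by rewrite (@transport_path _ _ [::] erefl). Qed.

Lemma transport_src a w x : has_path (tgt a) w ->
  transport (src a) w x = transport (tgt a) w (rep_map X a x).
Proof.
move=> [p hp]; rewrite (transport_path hp).
rewrite (@transport_path _ _ (a :: p) (conj erefl hp)) /=.
by rewrite (Prop_irrelevance (proj2 _) hp) (Prop_irrelevance (esym _) erefl).
Qed.

Lemma transport_arrow a x : transport (src a) (tgt a) x = rep_map X a x.
Proof. by rewrite transport_src ?transport_refl //; apply: has_path_refl. Qed.

Lemma transport_tgt u a x : has_path u (src a) ->
  transport u (tgt a) x = rep_map X a (transport u (src a) x).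
Proof.
move=> h; elim/has_path_ind: u / h x => [|b hb IH] x.
  by rewrite transport_refl transport_arrow.
rewrite !transport_src ?IH //.
exact: has_path_trans (has_path_arrow a).
Qed.
End Transport.

(** * Injective representations of a tree *)

Section InjectiveReps.
Variables (R : pzRingType) (T : tree) (X : rep R T).
Hypothesis X_inj : injective_rep X.
Implicit Types (u v w c : vertex T) (a b : arrow T).

(** Maps from a module A to X root are the same as maps to X from the constant
    representation A, and an injection of modules gives a monomorphism of
    constant representations. *)
Lemma root_injective : injective_module (X (Defs.root T)).
Proof.
move=> A B i f i_inj.
pose P := has_path (Defs.root T).
have allP u : P u by exact: has_path_root.
pose h u : {linear A -> X u} := transport X (Defs.root T) u \o f.
have [//|//|//|a x _ Ps _|a x _ []//|g gE] :=
  @extend_from_rep_on _ _ X P P (fun=> True) (fun=> True) A B i i_inj _ _ _ h X_inj.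
  by rewrite /h /= transport_tgt.
exists (g (Defs.root T) \o into_if `[< P (Defs.root T) >]) => x /=.
by rewrite gE // /h /= transport_refl.
Qed.

(** Any y in X (tgt a) is the image of the generator of a representation
    constant beyond [tgt a]; extending the representation to [src a] provides a
    preimage.  Taking the coefficients in X (tgt a) itself treats all y at
    once. *)
Lemma rep_map_surj a y : exists x, rep_map X a x = y.
Proof.
pose P u := has_path (tgt a) u; pose P' u := has_path (src a) u.
pose h u : {linear X (tgt a) -> X u} := transport X (tgt a) u.
have PP' u : P u -> P' u by apply: has_path_trans (has_path_arrow a).
have Ptgt b : P (src b) -> P (tgt b).
  by move=> h1; apply: has_path_trans h1 (has_path_arrow b).
have [//|b Ps _ _|b x _ Ps _|b x Ps []|g gE] :=
  @extend_from_rep_on _ _ X P P' (fun=> True) (fun=> True) _ _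
   (idfun : {linear X (tgt a) -> X (tgt a)}) (@inj_id _) PP' _ _ h X_inj.
- by split=> //; apply: Ptgt.
- by rewrite /h transport_tgt.
- by split=> //; apply: Ptgt.
have P's : P' (src a) by exact: has_path_refl.
have Pt : P (tgt a) by exact: has_path_refl.
exists (g (src a) (into_if `[< P' (src a) >] y)).
rewrite -hom_natural rep_on_mapE asboolT // into_ifK ?asboolT //.
by rewrite -[RHS](@transport_refl _ _ X) -/(h _ y) -gE ?asboolT //; apply: PP'.
Qed.

(** The largest subrepresentation of X concentrated at v. *)
Definition socle v : submodule (X v).
Proof.
exists (fun x => forall a, src a = v -> transport X v (tgt a) x = 0).
  by move=> a _; rewrite linear0.
by move=> k x y hx hy a av; rewrite linearP hx // hy // scaler0 addr0.
Defined.

(** With the predicate [at_vertex v] and no arrow, [rep_on] is the representation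
    concentrated at v; its maps to X are the maps into the socle at v. *)
Definition at_vertex v u : Prop := u = v.

Lemma socle_injective v : injective_module (submodule_type (socle v)).
Proof.
move=> A B i f i_inj.
pose h u : {linear A -> X u} := transport X v u \o (val \o f).
have [//|//|//|a x []//|a x Ps _|g gE] :=
  @extend_from_rep_on _ _ X (at_vertex v) (at_vertex v) (fun=> False) (fun=> False)
    A B i i_inj _ _ _ h X_inj.
  rewrite /h /= -transport_tgt; last by rewrite Ps; apply: has_path_refl.
  exact: (val_in_submodule (f x)).
have vv : at_vertex v v by [].
pose g0 : {linear B -> X v} := g v \o into_if `[< at_vertex v v >].
have g0_in y : in_submodule (socle v) (g0 y).
  move=> a av; subst v; rewrite transport_arrow -hom_natural rep_on_mapE.
  by rewrite asboolF // linear0.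
exists (corestrict g0_in) => x; apply: val_inj.
by rewrite /= gE // /h /= transport_refl.
Qed.

(** Every arrow before v acts as the identity of E on both sides of the
    naturality square, so the value at v determines the endomorphism. *)
Lemma e_vertex_endo v (E : lmodType R)
    (phi : rep_hom (e_vertex v E) (e_vertex v E)) :
  (forall x, phi v x = x) -> forall u x, phi u x = x.
Proof.
move=> phiv u x; case: (pselect (has_path u v)) => [uv|nuv]; last first.
  have e0 (y : e_vertex v E u) : y = 0 by exact: rep_on_zero.
  by rewrite [LHS]e0 [RHS]e0.
elim/has_path_ind: u / uv x => [//|a av IH] x.
rewrite -[LHS]from_ifK -[RHS]from_ifK.
have sv : has_path (src a) v := has_path_trans (has_path_arrow a) av.
rewrite -[in LHS]rep_on_map_in // -hom_natural IH.
by rewrite [in LHS]rep_on_map_in.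
Qed.

(** A nonzero socle at v splits e_*^v of that socle off X, so it is all of X. *)
Lemma vertex_case v (x : X v) : in_submodule (socle v) x -> x <> 0 ->
  indecomposable_rep X -> rep_iso X (e_vertex v (submodule_type (socle v))).
Proof.
move=> x_soc xnz X_indec; pose E : lmodType R := submodule_type (socle v).
have [pi piE] := @socle_injective v E (X v) val idfun val_inj.
pose h u : {linear E -> X u} := transport X v u \o val.
pose K a := has_path (src a) v /\ has_path (tgt a) v.
(* g extends the inclusion of the representation E concentrated at v. *)
have [u ->|//|a av [_ tv]|a y []//|a y Ps _|g gE] :=
  @extend_from_rep_on _ _ X (at_vertex v) (fun u => has_path u v) (fun=> False) K
    E E (idfun : {linear E -> E}) (@inj_id _) _ _ _ h X_inj.
- exact: has_path_refl.
- by case: (@no_path_back _ a); rewrite av.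
- rewrite /h /= -transport_tgt; last by rewrite Ps; apply: has_path_refl.
  exact: (val_in_submodule y).
pose k u : {linear X u -> E} := pi \o transport X u v.
have k_in a y : K a -> has_path (src a) v -> has_path (tgt a) v ->
    k (tgt a) (rep_map X a y) = k (src a) y.
  by move=> _ _ tv; rewrite /k /= transport_src.
have k_out a y : has_path (tgt a) v -> ~ (K a /\ has_path (src a) v) ->
    k (tgt a) (rep_map X a y) = 0.
  move=> tv; case; suff : has_path (src a) v by [].
  exact: has_path_trans (has_path_arrow a) tv.
pose r : rep_hom X (e_vertex v E) := hom_to_rep_on k_in k_out.
have vv := has_path_refl v; have bv := asboolT vv.
have gv y : g v (into_if _ y) = val y by rewrite gE // /h /= transport_refl.
have rgv y : hom_comp r g v y = y.
  by rewrite -[y]from_ifK /= gv transport_refl piE.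
have rg := e_vertex_endo rgv.
have gr_idem u y : hom_comp g r u (hom_comp g r u y) = hom_comp g r u y.
  by congr (g u _); apply: rg.
case: (indecomposable_idempotent gr_idem X_indec) => gr.
  (* g r = 0 would kill the given element x = g (y) = g r g (y). *)
  case: xnz; pose y : E := SubmoduleElt (asboolT x_soc).
  rewrite -[x]/(val y) -gv -[into_if _ y]rgv; exact: gr.
exists r, g; split=> u y; [exact: gr|exact: rg].
Qed.

(** * Injective representations with zero socle *)

Section ZeroSocle.
Hypothesis socle0 : forall v x, in_submodule (socle v) x -> x = 0.
Hypothesis X_indec : indecomposable_rep X.

Definition not_strict_ancestor c u : Prop := u = c \/ ~ has_path u c.

Lemma not_strict_ancestor_tgt c a :
  not_strict_ancestor c (src a) -> not_strict_ancestor c (tgt a).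
Proof.
move=> ca; right=> ac.
case: ca => [ca|]; first by apply: (@no_path_back _ a); rewrite ca.
by apply; apply: has_path_trans (has_path_arrow a) ac.
Qed.

(** If phi and psi agree beyond every arrow out of u, then their difference at u
    lies in the socle, hence vanishes.  Only one arrow out of u leads towards
    c, so induction along the path from u to c applies. *)
Lemma hom_eq_of_not_strict_ancestor c (Y : rep R T) (phi psi : rep_hom Y X) :
  (forall u x, not_strict_ancestor c u -> phi u x = psi u x) ->
  forall u x, phi u x = psi u x.
Proof.
move=> agree u x; case: (pselect (has_path u c)) => [uc|nuc]; last first.
  by apply: agree; right.
elim/has_path_ind: u / uc x => [|a ac IH] x; first by apply: agree; left.
apply/subr0_eq/socle0 => b eb; rewrite -eb in x *.
rewrite transport_arrow linearB -!hom_natural.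
apply/eqP; rewrite subr_eq0; apply/eqP.
case: (pselect (has_path (tgt b) c)) => [bc|nbc]; last by apply: agree; right.
have e : a = b by exact: branch_unique (esym eb) ac bc.
by subst a; apply: IH.
Qed.

(** The disjunction defines all of X u or the submodule 0, according to u. *)
Definition not_strict_ancestor_submodule c u : submodule (X u).
Proof.
exists (fun x => not_strict_ancestor c u \/ x = 0); first by right.
move=> k x y [cu|->]; first by left.
by move=> [cu|->]; [left|right; rewrite scaler0 addr0].
Defined.

Fact not_strict_ancestor_stable c a x :
  in_submodule (not_strict_ancestor_submodule c (src a)) x ->
  in_submodule (not_strict_ancestor_submodule c (tgt a)) (rep_map X a x).
Proof.
move=> [ca|->]; last by right; rewrite linear0.
by left; apply: not_strict_ancestor_tgt.
Qed.

(** The identity beyond c and 0 aside from c is an endomorphism of the part of X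
    not strictly before c.  Its extension phi to X is unique by
    [hom_eq_of_not_strict_ancestor], so phi is idempotent, hence 0 or 1; the
    first kills X beyond c, the second kills X aside from c. *)
Lemma zero_beyond_or_aside c :
  (forall u, has_path c u -> zero_module (X u)) \/
  (forall u, ~ has_path c u -> ~ has_path u c -> zero_module (X u)).
Proof.
pose S := subrep (@not_strict_ancestor_stable c).
pose f u : {linear S u -> X u} :=
  if pselect (has_path c u) then (val : {linear S u -> X u}) else \0.
have f1 u x : has_path c u -> f u x = val x by rewrite /f; case: pselect.
have f0 u x : ~ has_path c u -> f u x = 0 by rewrite /f; case: pselect.
have inS u x : not_strict_ancestor c u ->
    in_submodule (not_strict_ancestor_submodule c u) x by left.
have f_nat a x : f (tgt a) (rep_map S a x) = rep_map X a (f (src a) x).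
  case: (pselect (has_path c (src a))) => [ca|nca].
    by rewrite !f1 //; apply: has_path_trans ca (has_path_arrow a).
  rewrite (f0 (src a)) // linear0.
  case: (pselect (has_path c (tgt a))) => [ct|nct]; last by rewrite f0.
  rewrite f1 //=; have [et|//] := has_path_tgt ct.
  have [[es|ns]|->] := val_in_submodule x; last by rewrite linear0.
  - by case: nca; rewrite es; apply: has_path_refl.
  - by case: ns; rewrite et; apply: has_path_arrow.
(* phi is not explicit at the strict ancestors of c; only uniqueness controls
   it there. *)
have [phi phiE] :=
  X_inj (RepHom f_nat) (@subrep_incl_mono _ _ _ _ (@not_strict_ancestor_stable c)).
have phi1 u x : has_path c u -> phi u x = x.
  move=> cu; have nb : not_strict_ancestor c u.
    by case: (pselect (has_path u c)) => [uc|]; [left; apply: tree_anti|right].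
  pose y : S u := SubmoduleElt (asboolT (inS u x nb)).
  by have := phiE u y; rewrite /= f1.
have phi0 u x : ~ has_path c u -> ~ has_path u c -> phi u x = 0.
  move=> ncu nuc; have nb : not_strict_ancestor c u by right.
  pose y : S u := SubmoduleElt (asboolT (inS u x nb)).
  by have := phiE u y; rewrite /= f0.
have phi_idem u x : phi u (phi u x) = phi u x.
  apply: (@hom_eq_of_not_strict_ancestor c _ (hom_comp phi phi) phi).
  move=> {}u {}x nb /=.
  case: (pselect (has_path c u)) => [cu|ncu]; first by rewrite !phi1.
  rewrite (phi0 _ x) ?linear0 //; case: nb => // eu.
  by case: ncu; rewrite eu; apply: has_path_refl.
case: (indecomposable_idempotent phi_idem X_indec) => phiT; [left|right].
  by move=> u cu x; rewrite -[LHS](phi1 _ _ cu) phiT.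
by move=> u ncu nuc x; rewrite -[LHS]phiT phi0.
Qed.

Definition nonzero_at v : Prop := ~ zero_module (X v).

Lemma nonzero_src a : nonzero_at (tgt a) -> nonzero_at (src a).
Proof.
move=> nz z; apply: nz => y; have [x <-] := rep_map_surj y.
by rewrite (z x) linear0.
Qed.

Lemma nonzero_root : nonzero_at (Defs.root T).
Proof.
have [nz _] := X_indec; have [v nzv] : exists v, nonzero_at v.
  by apply/existsNP.
elim/has_path_ind_last: v / (has_path_root v) nzv => // a _ IH nz_a.
exact/IH/nonzero_src.
Qed.

(** The targets of two distinct arrows with a common source are incomparable. *)
Lemma nonzero_branch_unique a b : src a = src b ->
  nonzero_at (tgt a) -> nonzero_at (tgt b) -> a = b.
Proof.
move=> eab nza nzb; case: (zero_beyond_or_aside (tgt a)) => [z|z].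
  by case: nza; apply/z/has_path_refl.
apply: contrapT => nab; apply: nzb; apply: z => [ab|ba].
  have [/tgt_inj //|] := has_path_tgt ab.
  by rewrite -eab; apply: no_path_back.
have [/tgt_inj/esym //|] := has_path_tgt ba.
by rewrite eab; apply: no_path_back.
Qed.

Lemma nonzero_next v : nonzero_at v ->
  exists a, src a = v /\ nonzero_at (tgt a).
Proof.
move=> nzv; apply: contrapT => nex; apply: nzv => x; apply: socle0 => a av.
by apply: contrapT => xnz; apply: nex; exists a; split.
Qed.

(** No other arrow out of [src a] reaches the support, so the kernel of X a is the
    socle at [src a]. *)
Lemma nonzero_map_inj a : nonzero_at (tgt a) -> injective (rep_map X a).
Proof.
move=> nza; apply: raddf_inj => x xa0; apply: socle0 => b eb.
case: (pselect (nonzero_at (tgt b))) => [nzb|/contrapT]; last exact.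
by rewrite (nonzero_branch_unique eb nzb nza) transport_arrow.
Qed.

Lemma nonzero_transport_bij u : nonzero_at u ->
  injective (transport X (Defs.root T) u) /\
  forall y, exists x, transport X (Defs.root T) u x = y.
Proof.
elim/has_path_ind_last: u / (has_path_root u) => [_|a ra IH nza].
  split=> [x y|y]; first by rewrite !transport_refl.
  by exists y; rewrite transport_refl.
have [inj surj] := IH (nonzero_src nza); split=> [x y|y].
  by rewrite !transport_tgt // => /(nonzero_map_inj nza)/inj.
have [z <-] := rep_map_surj y; have [x <-] := surj z.
by exists x; rewrite transport_tgt.
Qed.

(** Starting from the root, following the only arrow that stays in the support
    gives w; the transports from the root form the isomorphism. *)
Lemma infinity_case : exists w : vertex_at_infinity T,
  rep_iso X (e_infinity w (X (Defs.root T))).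
Proof.
pose nza := {a : arrow T | nonzero_at (tgt a)}.
have [a0 [a0_src a0_nz]] := nonzero_next nonzero_root.
have next (s : nza) : {s' : nza | src (sval s') = tgt (sval s)}.
  case: s => a /= nz; have [b [bs bt]] := cid (nonzero_next nz).
  by exists (exist _ b bt).
pose s n : nza := iter n (fun s => sval (next s)) (exist _ a0 a0_nz).
have s_step i : tgt (sval (s i)) = src (sval (s i.+1)).
  by rewrite /s iterS; case: (next _).
pose w := @VertexAtInfinity T (fun i => sval (s i)) a0_src s_step.
exists w.
pose P u := exists j, u = src (inf_arrow w j) \/ u = tgt (inf_arrow w j).
have P_nz u : P u -> nonzero_at u.
  move=> [j]; have nzj : nonzero_at (tgt (inf_arrow w j)) := svalP (s j).
  by case=> ->; first exact: nonzero_src.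
have src_on a : P (src a) -> nonzero_at (tgt a) -> exists j, a = inf_arrow w j.
  move=> [j [e|e]] nz_a; [exists j|exists j.+1];
    apply: nonzero_branch_unique => //; try exact: svalP (s _).
  by rewrite e; apply: inf_arrow_step.
have nz_P u : nonzero_at u -> P u.
  elim/has_path_ind_last: u / (has_path_root u) => [_|a _ IH nz_a].
    by exists 0%N; left; rewrite inf_arrow_root.
  have [j ->] := src_on a (IH (nonzero_src nz_a)) nz_a.
  by exists j; right.
pose E := X (Defs.root T).
pose K a := exists j, a = inf_arrow w j.
pose h u : {linear E -> X u} := transport X (Defs.root T) u.
have h_in a x : K a -> P (src a) -> P (tgt a) ->
    rep_map X a (h (src a) x) = h (tgt a) x.
  by move=> _ _ _; rewrite /h transport_tgt //; apply: has_path_root.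
have h_out a x : P (src a) -> ~ (K a /\ P (tgt a)) ->
    rep_map X a (h (src a) x) = 0.
  move=> Ps nKP; apply: contrapT => nz0; apply: nKP.
  have nz_a : nonzero_at (tgt a) by move=> z; apply/nz0/z.
  by split; [apply: src_on|apply: nz_P].
have [f [g [fK gK]]] : rep_iso (rep_on P K E) X; last by exists g, f.
apply: (rep_iso_bij (f := hom_from_rep_on h_in h_out)) => u.
  case: (pselect (P u)) => [Pu|nPu]; last first.
    by move=> x y _; rewrite [LHS](rep_on_zero _ nPu) [RHS](rep_on_zero _ nPu).
  have [inj _] := nonzero_transport_bij (P_nz u Pu).
  by apply: inj_comp inj (can_inj (@from_ifK _ _ _)).
move=> y; case: (pselect (P u)) => [Pu|nPu]; last first.
  exists 0; rewrite linear0; symmetry.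
  by apply: (contrapT _ : zero_module (X u)) => nz; apply/nPu/nz_P.
have [_ surj] := nonzero_transport_bij (P_nz u Pu).
have [x <-] := surj y; exists (into_if _ x) => /=.
by rewrite into_ifK ?asboolT.
Qed.
End ZeroSocle.
End InjectiveReps.

Theorem theorem3p2 (R : pzRingType) (T : tree) (X : rep R T)
    (X_indec : indecomposable_rep X) (X_inj : injective_rep X) :
  exists E : lmodType R,
    indecomposable_module E /\ injective_module E /\
    ((exists v : vertex T, rep_iso X (e_vertex v E)) \/
     (exists w : vertex_at_infinity T, rep_iso X (e_infinity w E))).
Proof.
case: (pselect (exists v x, in_submodule (socle X v) x /\ x <> 0)).
  move=> [v [x [x_soc xnz]]].
  have iso := vertex_case X_inj x_soc xnz X_indec.
  exists (submodule_type (socle X v)); split; last split.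
  - pose P u := has_path u v.
    exact: (@indecomposable_rep_on _ _ P _ X _ v (has_path_refl v)) iso X_indec.
  - exact: socle_injective.
  - by left; exists v.
move=> no_socle.
have socle0 v x : in_submodule (socle X v) x -> x = 0.
  by move=> x_soc; apply: contrapT => xnz; apply: no_socle; exists v, x.
have [w iso] := infinity_case X_inj socle0 X_indec.
exists (X (Defs.root T)); split; last split.
- apply: indecomposable_rep_on iso X_indec; exists 0%N; left.
  exact/esym/inf_arrow_root.
- exact: root_injective.
- by right; exists w.
Qed.
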